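(* Let $T$ be a finite tree with $T\neq K_2$, and let $V_{even}(T)$ denote the set of vertices of $T$ of even degree. If $V_{even}(T)$ induces a path in $T$ and $|V_{even}(T)|$ is even, then $T$ is antimagic.
   Context: All graphs are finite, undirected and simple. A tree is a connected acyclic graph. $V_{even}(T)$ is the set of vertices of $T$ whose degree in $T$ is even. ''$V_{even}(T)$ induces a path'' means that the subgraph of $T$ induced by $V_{even}(T)$ is a path; the case $V_{even}(T)=\emptyset$ is included (the empty set is regarded as inducing the empty path). $K_2$ is the tree with exactly two vertices and one edge. An antimagic labeling of a connected graph $G$ is a bijection $\phi:E(G)\to\{1,2,\dots,|E(G)|\}$ such that the vertex sums $s(v)=\sum_{e\in E(v)}\phi(e)$, $v\in V(G)$, are pairwise distinct, where $E(v)$ is the set of edges incident to $v$. A graph is antimagic if it has an antimagic labeling. *)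

(* Defs.v *)
From mathcomp Require Import all_boot.

Set Implicit Arguments.
Unset Strict Implicit.
Unset Printing Implicit Defensive.

Record sgraph := SGraph {
  vertex :> finType;
  adj : rel vertex;
  adj_sym : symmetric adj;
  adj_irrefl : irreflexive adj
}.

Section Graphs.
Variable G : sgraph.

Definition edges : {set {set G}} :=
  [set [set x; y] | x in G, y in adj x].

Definition incident (v : G) : {set {set G}} := [set e in edges | v \in e].

Definition degree (v : G) : nat := #|[set w : G | adj v w]|.

Definition is_connected : Prop := 0 < #|G| /\ forall x y : G, connect (@adj G) x y.

(* [ucycle] also accepts closed walks with at most two vertices, such as
   [:: x; y] for an edge xy; the cycles of a simple graph are those with at
   least three. *)
Definition acyclic : Prop :=
  forall c : seq G, ucycle (@adj G) c -> size c < 3.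

Definition is_tree : Prop := is_connected /\ acyclic.

Definition is_K2 : Prop := #|G| = 2 /\ #|edges| = 1.

Definition V_even : {set G} := [set v | ~~ odd (degree v)].

(* The subgraph induced by S is the path that visits the vertices of S in the
   order s; s = [::] makes the empty set induce a path. *)
Definition induces_path (S : {set G}) : Prop :=
  exists s : seq G,
    [/\ uniq s, s =i S &
        {in S &, forall x y, adj x y =
           (index y s == (index x s).+1) || (index x s == (index y s).+1)}].

Definition vertex_sum (phi : {set G} -> nat) (v : G) : nat :=
  \sum_(e in incident v) phi e.

(* Only the values of phi on edges matter; the first two conditions say that
   phi restricts to a bijection from the edges onto {1, ..., #|edges|}. *)
Definition antimagic_labeling (phi : {set G} -> nat) : Prop :=
  [/\ {in edges &, injective phi},
      forall k : nat, (exists2 e, e \in edges & phi e = k) <->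
                      1 <= k <= #|edges| &
      injective (vertex_sum phi)].

Definition antimagic : Prop := exists phi, antimagic_labeling phi.

End Graphs.

(* Main.v *)
Require Import Defs.
From mathcomp Require Import all_boot zify.

Set Implicit Arguments.
Unset Strict Implicit.
Unset Printing Implicit Defensive.

(** Let [n = #|T|].  Root the tree at [r] and move the label of every edge to its
    lower end: a labelling of the edges by [1, ..., n - 1] becomes a bijection
    [L] from the vertices to [0, ..., n - 1] with [L r = 0], and the sum at [v]
    is [L v] plus the values of [L] on the children of [v]
    ([antimagic_rooted_sum]).  If the children of [v] come in pairs labelled
    [j] and [n - j], then the sum at [v] is congruent to [L v] modulo [n], and
    sums at such vertices are distinct.  Sums that are congruent modulo [n] at
    two exceptional vertices are compared through degrees, since a pair of
    children contributes exactly [n].  Passing to the labels [n - L] replaces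
    every sum [S v] by [n * degree v - S v]; this keeps the congruences and
    changes the relation between degrees that makes the sums equal
    ([antimagic_resolved]).  So it suffices to label a small set of vertices
    whose complement splits into pairs of siblings ([extend_labelling]).

    If all degrees are odd, the root is taken next to a leaf [w] and not a leaf
    itself; [w] gets [n / 2] and all other vertices are paired.  The sums at [w]
    and at the root are congruent, and differ because the root has more
    children ([antimagic_all_odd]).

    Otherwise let [x_0, ..., x_(2k-1)] be the path of even vertices, rooted at
    [x_0].  Both ends have even positive degree, so they have neighbours [u0]
    and [ul] off the path.  Apart from the path, [u0] and [ul], the children of
    each vertex come in pairs.  The vertices [u0, x_1, x_2, ..., x_(2k-1)] get
    [1, n - k, 2, n - k + 1, ..., k, n - 1].  Consecutive labels add up to
    [n - k + 1, n - k + 2, ...], so modulo [n] the sums at the path vertices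
    before the last one are labels of path vertices, 0 being the label of the
    root, and vertices off the path have other sums.  The one exception is the
    residue 1, the label of [u0], which occurs at [x_k] if [x_k] is not the last
    vertex.  There are two ways to label [ul].
    - [ul] gets [n / 2].  Then the sum at [x_(2k-1)] is congruent to
      [n / 2 - 1], and a vertex [w] of suitable degree is chosen to carry that
      label ([antimagic_half_end]).
    - [ul] gets [k + 1], so that the sum at [x_(2k-1)] continues the
      progression, and two children of [ul] get [n / 2] and [n - k - 1].  Then
      the sum at [ul] is congruent to [n / 2], the label of a child
      ([antimagic_split_end]).
    Each of these coincidences modulo [n] is harmless for [L] or for [n - L],
    depending on the degrees.  In [antimagic_spine] the first labelling with a
    leaf [w] works unless [degree u0 = degree x_k + 1].  In that case [n - L]
    is harmless for [u0], and it works with any [w] such that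
    [degree w + 1 != degree x_(2k-1)].  If there is no such [w], then all
    vertices off the path other than [u0] and [ul] are leaves, and the second
    labelling works as soon as [ul] is not a leaf.  If [ul] is a leaf, then the
    path is reversed and [ul] plays the role of [u0]: a leaf never has degree
    [degree x_k + 1]. *)

(** * Rooted trees *)

Record rooted (T : sgraph) (r : T) (par : T -> T) (d : T -> nat) : Prop := Rooted {
  par_depth : forall v, v != r -> d (par v) < d v;
  adj_par : forall x y,
    adj x y = (x != r) && (y == par x) || (y != r) && (x == par y)
}.

Lemma muln_small n m :
  (n * m = 0 /\ m = 0) \/ (n * m = n /\ m = 1) \/ n.*2 <= n * m.
Proof.
case: m => [|[|m]]; [left|right; left|right; right]; rewrite ?muln0 ?muln1 //.
by rewrite !mulnS addnA addnn leq_addr.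
Qed.

(** An edge of an acyclic graph is a bridge: a second way around would close a
    cycle of length at least three. *)
Lemma acyclic_bridge (T : sgraph) (x y : T) :
  acyclic T -> adj x y ->
  ~~ connect [rel a b | adj a b && ([set a; b] != [set x; y])] x y.
Proof.
move=> acT xy; apply/negP => /connectP[p /shortenP[q pq uq _] ylast].
have sizeq : size q < 2.
  have := acT (x :: q) _; apply; rewrite /ucycle /cycle uq andbT rcons_path.
  rewrite -ylast adj_sym xy andbT.
  by apply: sub_path pq => a b /andP[].
case: q pq uq ylast sizeq => [|z [|//]] /=.
  by move=> _ _ yx; rewrite yx adj_irrefl in xy.
by rewrite andbT => /andP[_ zxy] _ zy; rewrite zy eqxx in zxy.
Qed.

(** [par v] is a neighbour of [v] that is nearer to [r].  An edge [xy] that does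
    not join a vertex to its parent would not be a bridge, because both ends
    are connected to [r] by parent edges. *)
Lemma tree_rooted (T : sgraph) (r : T) :
  is_tree T -> exists par d, rooted r par d.
Proof.
move=> [[_ conT] acT].
pose walk v m := [exists p : m.-tuple T, path (@adj T) v p && (last v p == r)].
have exw v : exists m, walk v m.
  have /connectP[p pp rp] := conT v r.
  by exists (size p); apply/existsP; exists (in_tuple p); rewrite pp rp eqxx.
have [d dP] : exists d : T -> nat,
    forall v, walk v (d v) /\ forall m, walk v m -> d v <= m.
  apply: (fin_all_exists
    (P := fun v m => walk v m /\ forall m', walk v m' -> m <= m')).
  by move=> v; exists (ex_minn (exw v)); case: ex_minnP.
have [par parP] : exists par : T -> T,
    forall v, v != r -> adj v (par v) && (d (par v) < d v).
  apply: (fin_all_exists (P := fun v y => v != r -> adj v y && (d y < d v))) => v.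
  have [-> | vr] := eqVneq v r; first by exists r.
  have [/existsP[p /andP[pp /eqP lp]] _] := dP v.
  case: p pp lp => [[|y p] /= sp pp lp]; first by rewrite lp eqxx in vr.
  exists y => _; case/andP: pp => -> py /=.
  rewrite -(eqP sp) ltnS; apply: (dP y).2; apply/existsP.
  by exists (in_tuple p); rewrite py lp /=.
have parA v : v != r -> adj v (par v) by move/parP => /andP[].
have parD v : v != r -> d (par v) < d v by move/parP => /andP[].
exists par, d; split => // x y; apply/idP/idP; last first.
  case/orP => /andP[nr /eqP ->]; first exact: parA.
  by rewrite adj_sym parA.
move=> xy; apply: contraT => /norP[nx ny].
case/negP: (acyclic_bridge acT xy).
set e := [rel a b | _].
have esym : connect_sym e.
  by apply: sym_connect_sym => a b /=; rewrite adj_sym (setUC [set a]).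
have toroot v : connect e v r.
  have [m] := ubnP (d v); elim: m v => // m IHm v ltv.
  have [-> | vr] := eqVneq v r; first exact: connect0.
  apply: (connect_trans (y := par v)); last first.
    by apply: IHm; have := parD v vr; lia.
  apply: connect1; rewrite /= parA //=.
  apply/negP => /eqP/setP exy.
  have := exy x; have := exy y; have := exy v; rewrite !inE !eqxx !orbT /=.
  case: (eqVneq v x) => [vx _ | _]; last case: (eqVneq v y) => // vy _.
    rewrite -vx; case/orP=> [/eqP yv | ypar _].
      by rewrite yv vx adj_irrefl in xy.
    by rewrite -vx vr ypar in nx.
  move=> _ /= xpar.
  by rewrite -vy vr xpar in ny.
by apply: connect_trans (toroot x) _; rewrite esym.
Qed.

Section Rooted.
Variables (T : sgraph) (r : T) (par : T -> T) (d : T -> nat).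
Hypothesis rT : rooted r par d.

Definition children v := [set c : T | (c != r) && (par c == v)].

Lemma par_neq v : v != r -> par v != v.
Proof. by move/(par_depth rT) => lt; apply/eqP => e; rewrite e ltnn in lt. Qed.

Lemma degree_children v : degree v = (v != r) + #|children v|.
Proof.
rewrite /degree; have [-> | vr] := eqVneq v r.
  by apply: eq_card => w; rewrite !inE (adj_par rT) eqxx (eq_sym r).
have pv : par v \notin children v.
  rewrite inE; apply/andP => -[pr /eqP pp].
  by have := par_depth rT pr; rewrite pp; have := par_depth rT vr; lia.
have -> : [set w | adj v w] = par v |: children v.
  by apply/setP => w; rewrite !inE (adj_par rT) vr (eq_sym v).
by rewrite cardsU1 pv.
Qed.

Definition par_edge v : {set T} := [set v; par v].

Lemma par_edge_inj : {in [set~ r] &, injective par_edge}.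
Proof.
move=> v w; rewrite !inE => vr wr e; apply/eqP; apply: contraT => vw.
have /setP/(_ v) := e; have /setP/(_ w) := e; rewrite !inE !eqxx /=.
rewrite (eq_sym w v) (negPf vw) /= => /eqP wv /esym/eqP vw'.
by have := par_depth rT vr; have := par_depth rT wr; rewrite -wv -vw'; lia.
Qed.

Lemma edges_par : edges T = par_edge @: [set~ r].
Proof.
apply/setP => e; apply/imset2P/imsetP => [[x y _ xy ->] | [v]].
  move: xy; rewrite -topredE /= (adj_par rT) => xy.
  case/orP: xy => /andP[nr /eqP->]; first by exists x; rewrite ?inE.
  by exists y; rewrite ?inE // /par_edge setUC.
rewrite !inE => vr ->; exists v (par v) => //.
by rewrite -topredE /= (adj_par rT) vr eqxx.
Qed.

(** * Labels on vertices instead of edges *)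

Definition rooted_sum (L : T -> nat) v := L v + \sum_(c in children v) L c.

(** [L v] serves as the label of the edge from [v] to its parent.  As [L r = 0],
    the root takes the one value that is not an edge label, and its own term in
    the sum vanishes. *)
Lemma antimagic_rooted_sum (L : T -> nat) :
  injective L -> (forall v, L v < #|T|) -> L r = 0 -> injective (rooted_sum L) ->
  antimagic T.
Proof.
move=> Linj Lbd Lr Sinj.
have m1 : #|edges T| = #|T|.-1.
  by rewrite edges_par card_in_imset ?cardsC1 //; exact: par_edge_inj.
pose phi (e : {set T}) := \sum_(v in [set~ r] | par_edge v == e) L v.
have phiE v : v != r -> phi (par_edge v) = L v.
  move=> vr; rewrite /phi (big_pred1 v) // => w; rewrite /= !inE.
  apply/andP/eqP => [[wr /eqP e] | ->]; last by rewrite vr eqxx.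
  by apply: par_edge_inj; rewrite ?inE.
have L0 v : v != r -> 0 < L v by move=> vr; rewrite lt0n -Lr (inj_eq Linj).
exists phi; split.
- move=> e f; rewrite edges_par => /imsetP[v] + -> /imsetP[w] + ->.
  by rewrite !inE => vr wr; rewrite !phiE // => /Linj ->.
- move=> j; rewrite m1; split.
    case=> e; rewrite edges_par => /imsetP[v]; rewrite !inE => vr -> <-.
    by rewrite phiE //; have := Lbd v; have := L0 v vr; lia.
  case/andP=> j0 jn.
  have jn' : j < #|T| by move: jn j0; clear; lia.
  pose F v : 'I_#|T| := Ordinal (Lbd v).
  have Finj : injective F by move=> v w /(congr1 val) /Linj.
  have cardF : #|'I_#|T| | <= #|T| by rewrite card_ord.
  have /imageP[v _ /(congr1 val) /= jv] := inj_card_onto Finj cardF (Ordinal jn').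
  have vr : v != r by apply: contraTneq j0 => vr; rewrite jv vr Lr.
  by exists (par_edge v); rewrite ?phiE // edges_par imset_f // !inE.
- suff E v : vertex_sum phi v = rooted_sum L v.
    by move=> v w; rewrite !E; apply: Sinj.
  rewrite /vertex_sum /incident.
  have -> : [set e in edges T | v \in e]
      = par_edge @: [set c | (c != r) && ((c == v) || (par c == v))].
    apply/setP => e; rewrite inE edges_par; apply/andP/imsetP.
      case=> /imsetP[c]; rewrite !inE => cr ->; rewrite !inE => h; exists c => //.
      by rewrite inE cr eq_sym (eq_sym _ v).
    case=> c; rewrite !inE => /andP[cr h] ->; split.
      by rewrite imset_f ?inE.
    by rewrite !inE eq_sym (eq_sym v (par c)).
  rewrite big_imset /=; last first.
    move=> a b; rewrite !inE => /andP[ar _] /andP[br _] e.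
    by apply: par_edge_inj; rewrite ?inE.
  (* the root may occur on the right only; it contributes [L r = 0] *)
  transitivity (\sum_(c in v |: children v) L c).
    rewrite [RHS](bigID (fun c => c == r)) /=.
    rewrite [X in _ = X + _]big1 => [|c /andP[_ /eqP->] //].
    rewrite add0n; apply: eq_big => [c | c].
      by rewrite !inE andbC; case: (c != r); rewrite ?andbT ?andbF.
    by rewrite inE => /andP[cr _]; rewrite phiE.
  rewrite big_setU1 //= inE; apply/negP => /andP[vr].
  by rewrite (negPf (par_neq vr)).
Qed.

Definition compl_label (L : T -> nat) v := if v == r then 0 else #|T| - L v.

Section Complement.
Variable L : T -> nat.
Hypotheses (Linj : injective L) (Lbd : forall v, L v < #|T|) (Lr : L r = 0).

Lemma label_gt0 v : v != r -> 0 < L v.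
Proof. by move=> vr; rewrite lt0n -Lr (inj_eq Linj). Qed.

Lemma compl_label_inj : injective (compl_label L).
Proof.
move=> v w; rewrite /compl_label; move: (Lbd v) (Lbd w).
case: (eqVneq v r) (eqVneq w r) => [->|vr] [->|wr] // lv lw e.
- by move: lw e; clear; lia.
- by move: lv e; clear; lia.
by apply: Linj; move: lv lw e; clear; lia.
Qed.

Lemma compl_label_lt v : compl_label L v < #|T|.
Proof.
rewrite /compl_label; case: eqVneq => [_ | /label_gt0].
  by apply/card_gt0P; exists r.
by move: (Lbd v); clear; lia.
Qed.

Lemma rooted_sum_compl v :
  rooted_sum L v + rooted_sum (compl_label L) v = #|T| * degree v.
Proof.
have LE c : L c + compl_label L c = #|T| * (c != r).
  rewrite /compl_label; case: eqP => [->|_]; first by rewrite Lr muln0.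
  by rewrite muln1 subnKC // ltnW.
rewrite degree_children /rooted_sum mulnDr -LE addnACA -big_split /=.
congr (_ + _); rewrite mulnC -sum_nat_const; apply: eq_bigr => c.
by rewrite inE LE => /andP[-> _]; rewrite muln1.
Qed.

End Complement.

(** * Pairing siblings with complementary labels *)

Lemma fresh_label (D : {set T}) (f : T -> nat) :
  #|D| < #|T| -> exists2 j, j < #|T| & {in D, forall z, f z != j}.
Proof.
move=> ltD; pose labels := map f (enum D).
have [/allP sub | /allPn[j]] := boolP (all (mem labels) (iota 0 #|T|)).
  have := uniq_leq_size (iota_uniq 0 #|T|) sub.
  by rewrite size_iota size_map -cardE leqNgt ltD.
rewrite mem_iota /= => jn jf; exists j => // z zD.
by apply: contraNneq jf => <-; rewrite map_f ?mem_enum.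
Qed.

(** The conditions under which the vertices outside [D] can be labelled in
    sibling pairs [j], [#|T| - j]: the labels used on [D] are closed under
    complement, and [label_half] ensures that an unused label differs from its
    complement. *)
Record partial_labelling (D : {set T}) (f : T -> nat) : Prop := PartialLabelling {
  label_root : r \in D /\ f r = 0;
  label_inj : {in D &, injective f};
  label_lt : {in D, forall z, f z < #|T|};
  label_half : exists2 z, z \in D & (f z).*2 = #|T|;
  label_compl : {in D, forall z, 0 < f z ->
                   exists2 z', z' \in D & f z' = #|T| - f z};
  label_even : forall v, ~~ odd #|children v :\: D|
}.

(** Induction on the number of unlabelled vertices: an unlabelled vertex has an
    unlabelled sibling, and these two take an unused label and its complement.
    The first vertex to be treated is [w], which allows its label to be
    prescribed. *)
Lemma extend_labelling D f w t :
  partial_labelling D f ->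
  (if w \in D then f w = t else t < #|T| /\ {in D, forall z, f z != t}) ->
  exists L : T -> nat,
    [/\ injective L, forall v, L v < #|T|, {in D, L =1 f}, L w = t &
        forall v, (\sum_(c in children v :\: D) L c).*2
                  = #|T| * #|children v :\: D|].
Proof.
have [m] := ubnP #|~: D|; elim: m D f => // m IHm D f ltm pf wt.
have [rD fr] := label_root pf.
have [/eqP|] := posnP #|~: D|.
  rewrite cards_eq0 => /eqP D0.
  have inD v : v \in D by rewrite -[D]setCK D0 setC0 inE.
  exists f; split=> //.
  - by move=> a b; apply: (label_inj pf).
  - by move=> v; apply: (label_lt pf).
  - by rewrite inD in wt.
  by move=> v; rewrite setDE D0 setI0 big_set0 cards0 muln0.
rewrite card_gt0 => /set0Pn[x0]; rewrite inE => x0D.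
have [x [j [xD jn jf xw]]] : exists x j,
    [/\ x \notin D, j < #|T|, {in D, forall z, f z != j} &
        if w \in D then true else (x == w) && (j == t)].
  move: wt; case: (boolP (w \in D)) => [_ _ | wD [tn tf]]; last first.
    by exists w, t; rewrite !eqxx.
  have [|j jn jf] := @fresh_label D f; last by exists x0, j.
  have : 0 < #|~: D| by apply/card_gt0P; exists x0; rewrite inE.
  by have := cardsC D; lia.
pose p := par x.
have xr : x != r by apply: contraNneq xD => ->.
have xp : x \in children p :\: D by rewrite !inE xD xr /p eqxx.
have [y] : exists y, y \in (children p :\: D) :\ x.
  apply/set0Pn; rewrite -card_gt0.
  by have := label_even pf p; rewrite (cardsD1 x) xp; case: #|_|.
rewrite !inE => /and4P[yx yD yr /eqP yp].
have j0 : 0 < j by rewrite lt0n; apply: contraNneq (jf _ rD) => ->; rewrite fr.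
have jj : j + j != #|T|.
  have [z zD zn] := label_half pf.
  by move: (jf z zD) zn; clear; lia.
have jf' : {in D, forall z, f z != #|T| - j}.
  move=> z zD; apply/negP => /eqP fz.
  have [|z' z'D fz'] := label_compl pf zD; first by move: fz j0 jn; clear; lia.
  by move: (jf _ z'D) fz' fz jn; clear; lia.
pose D' := x |: (y |: D).
pose f' z := if z == x then j else if z == y then #|T| - j else f z.
have fD z : z \in D -> f' z = f z.
  move=> zD; rewrite /f'; case: eqP zD xD => [-> -> //|_].
  by case: eqP yD => [-> /negPf-> //|].
have fx : f' x = j by rewrite /f' eqxx.
have fy : f' y = #|T| - j by rewrite /f' (negPf yx) eqxx.
have chD v : children v :\: D =
    if v == p then x |: (y |: (children v :\: D')) else children v :\: D'.
  case: (eqVneq v p) => [-> | vp]; apply/setP => c; rewrite !inE /=.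
    case: (eqVneq c x) => [-> | _] /=; first by rewrite xD xr /p eqxx.
    by case: (eqVneq c y) => [-> | _] //=; rewrite yD yr yp eqxx.
  case: (eqVneq c x) => [-> | _] /=.
    by rewrite (eq_sym _ v) (negPf vp) !andbF.
  by case: (eqVneq c y) => [-> | _] //=; rewrite yp (eq_sym p) (negPf vp) !andbF.
have nx v : x \notin y |: (children v :\: D').
  by rewrite !inE eq_sym (negPf yx) eqxx.
have ny v : y \notin children v :\: D' by rewrite !inE eqxx orbT.
have cardD v : #|children v :\: D| =
    (if v == p then 2 else 0) + #|children v :\: D'|.
  by rewrite chD; case: ifP => // _; rewrite !cardsU1 nx ny.
have pf' : partial_labelling D' f'.
  split.
  - by rewrite !inE rD !orbT fD.
  - have aux a b : a \in D' -> b \in D' -> f' a = f' b -> a != b ->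
        (a == x) || (a == y) -> False.
      move=> aD bD + ab /orP[] /eqP ea; subst a.
        move: bD; rewrite !inE eq_sym (negPf ab) /= => /orP[/eqP-> | bD].
          by rewrite fx fy; move: jj jn; clear; lia.
        by rewrite fx fD // => e; have := jf b bD; rewrite e eqxx.
      move: bD; rewrite !inE (eq_sym b y) (negPf ab) /= => /orP[/eqP-> | bD].
        by rewrite fx fy; move: jj jn; clear; lia.
      by rewrite fy fD // => e; have := jf' b bD; rewrite e eqxx.
    move=> a b aD bD e; apply/eqP; apply: contraT => ab.
    have [ax | /norP[ax ay]] := boolP ((a == x) || (a == y)).
      by case: (aux a b).
    have [bx | /norP[bx bY]] := boolP ((b == x) || (b == y)).
      by case: (aux b a) => //; rewrite eq_sym.
    have aD' : a \in D by move: aD; rewrite !inE (negPf ax) (negPf ay).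
    have bD' : b \in D by move: bD; rewrite !inE (negPf bx) (negPf bY).
    by rewrite !fD // in e; rewrite (label_inj pf aD' bD' e) eqxx in ab.
  - move=> z; rewrite !inE => /or3P[/eqP->|/eqP->|zD].
    + by rewrite fx.
    + by rewrite fy; move: j0 jn; clear; lia.
    by rewrite fD // (label_lt pf).
  - have [z zD zn] := label_half pf; exists z; first by rewrite !inE zD !orbT.
    by rewrite fD.
  - move=> z; rewrite !inE => /or3P[/eqP->|/eqP->|zD].
    + by move=> _; exists y; rewrite ?inE ?eqxx ?orbT // fx fy.
    + by move=> _; exists x; rewrite ?inE ?eqxx ?orbT // fx fy subKn // ltnW.
    rewrite fD // => f0; have [z' z'D fz'] := label_compl pf zD f0.
    by exists z'; rewrite ?inE ?z'D ?orbT // fD.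
  - by move=> v; have := label_even pf v; rewrite cardD; case: (v == p); clear; lia.
have ltm' : #|~: D'| < m.
  apply: leq_ltn_trans (_ : #|~: D :\ x| < m).
    by apply/subset_leq_card/subsetP => z; rewrite !inE !negb_or => /and3P[-> _ ->].
  by move: ltm; rewrite (cardsD1 x (~: D)) inE xD.
have wt' : if w \in D' then f' w = t else t < #|T| /\ {in D', forall z, f' z != t}.
  move: wt xw; case: (boolP (w \in D)) => [wD wt _ | _ _ /andP[/eqP <- /eqP <-]].
    by rewrite !inE wD !orbT fD.
  by rewrite !inE eqxx fx.
have [L [Linj Lbd LD Lw Lsum]] := IHm D' f' ltm' pf' wt'.
have Lx : L x = j by rewrite LD ?fx // !inE eqxx.
have Ly : L y = #|T| - j by rewrite LD ?fy // !inE eqxx orbT.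
exists L; split=> //.
  by move=> z zD; rewrite LD ?fD // !inE zD !orbT.
move=> v; rewrite cardD mulnDr -Lsum chD; case: (v == p); last by rewrite muln0.
rewrite !big_setU1 //= Lx Ly.
by rewrite addnA subnKC 1?ltnW // doubleD muln2.
Qed.

(** Modulo [#|T|] only these edges count in the sum at [v] once the children
    outside [D] are paired: the parent edge and the edges to children in [D]. *)
Definition unpaired_sum (D : {set T}) (L : T -> nat) v :=
  L v + \sum_(c in children v :&: D) L c.
Definition unpaired_degree (D : {set T}) v := (v != r) + #|children v :&: D|.

Lemma unpaired_degreeE (D : {set T}) v :
  degree v = unpaired_degree D v + #|children v :\: D|.
Proof. by rewrite degree_children -(cardsID D) addnA. Qed.

Lemma unpaired_degree_le (D : {set T}) v : unpaired_degree D v <= degree v.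
Proof. by rewrite (unpaired_degreeE D) leq_addr. Qed.

Lemma rooted_sum_paired (D : {set T}) (L : T -> nat) v :
  (\sum_(c in children v :\: D) L c).*2 = #|T| * #|children v :\: D| ->
  ~~ odd #|children v :\: D| ->
  exists q, rooted_sum L v = unpaired_sum D L v + #|T| * q /\
            degree v = unpaired_degree D v + q.*2.
Proof.
rewrite (unpaired_degreeE D) => sum_pairs ev.
exists #|children v :\: D|./2; rewrite even_halfK //; split=> //.
rewrite /rooted_sum /unpaired_sum (big_setID D) /= addnA; congr (_ + _).
apply: double_inj; rewrite sum_pairs -[in LHS](even_halfK ev).
by rewrite -!muln2 mulnA.
Qed.

(** Suppose that [v] and [v'] have congruent sums, with
    [unpaired_sum D L v' = unpaired_sum D L v + #|T| * m].  By
    [rooted_sum_paired] the sums are equal exactly when the numbers of pairs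
    below [v] and [v'] differ by [m], which is a relation between degrees.  For
    the complementary labels the sums are [#|T| * degree - rooted_sum], and they
    are equal under a different relation between degrees. *)
Definition resolved (flip : bool) (D : {set T}) v v' m :=
  if flip then
    degree v + unpaired_degree D v + m.*2 != degree v' + unpaired_degree D v'
  else
    degree v + unpaired_degree D v' != degree v' + unpaired_degree D v + m.*2.

Lemma antimagic_resolved (D : {set T}) (L : T -> nat) (flip : bool) :
  injective L -> (forall v, L v < #|T|) -> L r = 0 ->
  (forall v,
     (\sum_(c in children v :\: D) L c).*2 = #|T| * #|children v :\: D|) ->
  (forall v, ~~ odd #|children v :\: D|) ->
  (forall v v' m, v != v' ->
     unpaired_sum D L v' = unpaired_sum D L v + #|T| * m ->
     resolved flip D v v' m) ->
  antimagic T.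
Proof.
move=> Linj Lbd Lr Lsum Leven res; rewrite /resolved in res.
have n0 : 0 < #|T| by apply/card_gt0P; exists r.
have [Q QE] := fin_all_exists (fun v => rooted_sum_paired (Lsum v) (Leven v)).
pose S v := rooted_sum (if flip then compl_label L else L) v.
have SE v : S v + (if flip then unpaired_sum D L v + #|T| * Q v else 0) =
            if flip then #|T| * degree v else unpaired_sum D L v + #|T| * Q v.
  have [sumE _] := QE v; rewrite -sumE /S; case: (flip); last by rewrite addn0.
  by rewrite addnC rooted_sum_compl.
have clash v v' m : v != v' ->
    unpaired_sum D L v' = unpaired_sum D L v + #|T| * m -> S v <> S v'.
  move=> vv' e eS; have := res _ _ m vv' e; have := SE v; have := SE v'.
  have [_ dv] := QE v; have [_ dv'] := QE v'.
  rewrite eS e; case: (flip) => e1 e2 /eqP; apply.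
    have /eqP : #|T| * (degree v + m + Q v') = #|T| * (degree v' + Q v).
      by rewrite !mulnDr -e1 -e2; clear; lia.
    by rewrite eqn_pmul2l // => /eqP; move: dv dv'; clear; lia.
  have /eqP : #|T| * Q v = #|T| * (m + Q v').
    by rewrite mulnDr; move: e1 e2; clear; lia.
  by rewrite eqn_pmul2l // => /eqP; move: dv dv'; clear; lia.
have Sinj : injective S.
  move=> v v' eS; apply/eqP; apply: contraT => vv'.
  have [a [a' e]] : exists a a',
      unpaired_sum D L v + #|T| * a = unpaired_sum D L v' + #|T| * a'.
    have := SE v; have := SE v'; rewrite eS; case: (flip) => e1 e2.
      exists (Q v + degree v'), (Q v' + degree v).
      by rewrite !mulnDr -e1 -e2; clear; lia.
    by exists (Q v), (Q v'); rewrite -e1 -e2.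
  case: (leqP a a') => [/subnKC aa | /ltnW/subnKC aa]; rewrite -aa mulnDr in e.
    have v'v : v' != v by rewrite eq_sym.
    by case: (@clash v' v (a' - a) v'v) => //; move: e; clear; lia.
  by case: (@clash v v' (a - a') vv') => //; move: e; clear; lia.
apply: (antimagic_rooted_sum _ _ _ Sinj); case: (flip) => //.
- exact: compl_label_inj.
- exact: compl_label_lt.
by rewrite /compl_label eqxx.
Qed.

Lemma antimagic_extension (D : {set T}) (f : T -> nat) w t (flip : bool) :
  partial_labelling D f ->
  (if w \in D then f w = t else t < #|T| /\ {in D, forall z, f z != t}) ->
  (forall L : T -> nat,
     injective L -> (forall v, L v < #|T|) -> {in D, L =1 f} -> L w = t ->
     forall v v' m, v != v' ->
     unpaired_sum D L v' = unpaired_sum D L v + #|T| * m ->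
     resolved flip D v v' m) ->
  antimagic T.
Proof.
move=> pf wt good; have [L [Linj Lbd LD Lw Lsum]] := extend_labelling pf wt.
have [rD fr] := label_root pf.
apply: (antimagic_resolved (D := D) (flip := flip) Linj Lbd) => //.
- by rewrite LD.
- exact: label_even pf.
by move=> v v' m; apply: (good L).
Qed.

Lemma even_unlabelled (D : {set T}) :
  r \in D -> (forall v, ~~ odd #|children v :\: D|) -> ~~ odd #|~: D|.
Proof.
move=> rD evD; rewrite -sum1_card (partition_big par predT) //=.
apply: (big_ind (fun m => ~~ odd m)) => // [a b | v _].
  by rewrite oddD => /negPf-> /negPf->.
have := evD v; rewrite -sum1_card; congr (~~ odd _); apply: eq_bigl => c.
rewrite !inE; case: (boolP (c \in D)) => //= cD.
by have [cr | //] := eqVneq c r; rewrite cr rD in cD.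
Qed.

Lemma card_edges : #|edges T| = #|T|.-1.
Proof. by rewrite edges_par card_in_imset ?cardsC1 //; exact: par_edge_inj. Qed.

(** * All degrees odd *)

Section RootedAtLeafNeighbour.
Variable w : T.
Hypotheses (wr : w \in children r) (w1 : degree w = 1) (r1 : 1 < degree r).
Hypothesis all_odd : forall v : T, odd (degree v).

Lemma antimagic_all_odd_rooted : antimagic T.
Proof.
have := wr; rewrite inE => /andP[nwr /eqP pw].
pose D := [set r; w].
have chD v : children v :&: D = if v == r then [set w] else set0.
  apply/setP => c; rewrite (fun_if (fun A : {set T} => c \in A)) !inE.
  case: (eqVneq c r) => [->|cr] /=; first by rewrite (eq_sym r) (negPf nwr) if_same.
  case: (eqVneq c w) => [->|_]; first by rewrite pw andbT eq_sym; case: eqP.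
  by rewrite andbF if_same.
have unpaired1 v : unpaired_degree D v = 1.
  by rewrite /unpaired_degree chD; case: eqP; rewrite ?cards1 ?cards0.
have evD v : ~~ odd #|children v :\: D|.
  have := all_odd v; have := unpaired1 v.
  by rewrite (unpaired_degreeE D); clear; lia.
have rD : r \in D by rewrite !inE eqxx.
have evn : ~~ odd #|T|.
  have := even_unlabelled rD evD; rewrite -(cardsC D) oddD => /negPf->.
  by rewrite cards2 eq_sym nwr.
pose f z := if z == r then 0 else #|T|./2.
have T2 : 1 < #|T| by have := max_card (mem D); rewrite cards2 eq_sym nwr.
have fw : f w = #|T|./2 by rewrite /f (negPf nwr).
have fr : f r = 0 by rewrite /f eqxx.
apply: (@antimagic_extension D f r 0 false); last 1 first.
- move=> L Linj Lbd LD _ v v' m vv'; rewrite /resolved !unpaired1.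
  have sumE z : unpaired_sum D L z = if z == r then #|T|./2 else L z.
    rewrite /unpaired_sum chD; case: eqP => [->|_]; last by rewrite big_set0 addn0.
    by rewrite big_set1 !LD ?fw ?fr // !inE eqxx ?orbT.
  have Lw : L w = #|T|./2 by rewrite LD ?fw // !inE eqxx orbT.
  have {}sumE z : unpaired_sum D L z = L (if z == r then w else z).
    by rewrite sumE; case: eqP.
  rewrite !sumE => e.
  have m0 : m = 0.
    move: e; have := Lbd (if v' == r then w else v').
    by case: m => // m; rewrite mulnS; lia.
  move: e; rewrite m0 muln0 addn0 => /Linj.
  case: (eqVneq v' r) (eqVneq v r) vv' => [->|vr'] [->|vr]; rewrite ?eqxx //.
  + by move=> _ <-; rewrite w1; lia.
  + by move=> _ ->; rewrite w1; lia.
  by move=> /negP nvv' vv'; case: nvv'; rewrite vv'.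
- split=> //.
  + move=> a b; rewrite !inE => /orP[/eqP->|/eqP->] /orP[/eqP->|/eqP->];
      rewrite ?fw ?fr //; lia.
  + by move=> z; rewrite !inE => /orP[/eqP->|/eqP->]; rewrite ?fw ?fr //; lia.
  + by exists w; rewrite ?fw ?inE ?eqxx ?orbT ?even_halfK.
  + move=> z; rewrite !inE => /orP[/eqP->|/eqP->]; rewrite ?fw ?fr // => _.
    by exists w; rewrite ?fw ?inE ?eqxx ?orbT //; lia.
- by rewrite rD.
Qed.
End RootedAtLeafNeighbour.

(** * The path of even vertices *)

Section Spine.
Variables (s : seq T) (k : nat) (u0 ul : T).
(* the default value makes [ul] the vertex [x k.*2] that follows the path *)
Let x i := nth ul s i.
Hypotheses (sz : size s = k.*2) (k0 : 0 < k) (us : uniq s) (x0 : x 0 = r).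
Hypothesis xpar : forall i, i < k.*2 -> par (x i.+1) = x i.
Hypotheses (u0s : u0 \notin s) (uls : ul \notin s) (u0l : u0 != ul).
Hypothesis u0par : par u0 = r.
Hypothesis odd_degree : forall v : T, odd (degree v) = (v \notin s).

Lemma spine_inj i j : i <= k.*2 -> j <= k.*2 -> x i = x j -> i = j.
Proof.
have xE a : x a = nth ul (rcons s ul) a.
  rewrite nth_rcons /x; case: ltngtP => // h; rewrite ?h nth_default //; lia.
move=> ik jk /eqP; rewrite !xE nth_uniq ?size_rcons ?sz ?rcons_uniq ?us ?uls //.
by move/eqP.
Qed.

Lemma spine_in i : i < k.*2 -> x i \in s.
Proof. by move=> ik; rewrite mem_nth ?sz. Qed.

Lemma spine_last : x k.*2 = ul.
Proof. by rewrite /x nth_default ?sz. Qed.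

Lemma spineP v : v \in s -> exists2 i, i < k.*2 & v = x i.
Proof.
by move=> vs; exists (index v s); rewrite ?/x ?nth_index // -sz index_mem.
Qed.

Lemma root_in_spine : r \in s.
Proof. by rewrite -x0 spine_in //; lia. Qed.

Lemma spine_root i : i <= k.*2 -> x i = r -> i = 0.
Proof. by rewrite -x0 => ik /spine_inj ->. Qed.

Definition core : {set T} := [set z | z \in [:: u0, ul & s]].

Lemma card_core : #|core| = k.*2.+2.
Proof.
rewrite cardsE; have /card_uniqP -> : uniq [:: u0, ul & s].
  by rewrite /= us uls inE negb_or u0l u0s.
by rewrite /= sz.
Qed.

Lemma core_parent c : c \in core -> c != r ->
  c = u0 \/ exists2 i, i < k.*2 & c = x i.+1.
Proof.
rewrite !inE => /or3P[/eqP->|/eqP->|/spineP[[|i] ik ->]] cr.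
- by left.
- right; exists k.*2.-1; first by move: k0; clear; lia.
  by rewrite prednK ?spine_last // double_gt0.
- by rewrite x0 eqxx in cr.
by right; exists i; first exact: ltnW.
Qed.

Lemma core_parent_in c : c \in core -> c != r -> par c \in s.
Proof.
move=> cc cr; case: (core_parent cc cr) => [->|[i ik ->]].
  by rewrite u0par root_in_spine.
by rewrite xpar ?spine_in.
Qed.

(** The labelled vertices are those of [core] and a set [C] of children of [ul].
    [C] is empty when [ul] takes the middle label, and has two elements in the
    other labelling. *)
Section Extra.
Variable C : {set T}.
Hypotheses (Cul : C \subset children ul) (Cev : ~~ odd #|C|).

Let D := core :|: C.

Lemma extra_child c : c \in C -> [/\ c != r, par c = ul & c \notin core].
Proof.
move/(subsetP Cul); rewrite inE => /andP[cr /eqP pc]; split=> //.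
by apply: contra uls => cc; rewrite -pc core_parent_in.
Qed.

Lemma core_labelled c : c \in core -> c \in D.
Proof. by rewrite [c \in D]inE => ->. Qed.

Lemma spine_core i : i <= k.*2 -> x i \in core.
Proof.
rewrite leq_eqVlt => /orP[/eqP->|ik]; first by rewrite spine_last !inE eqxx orbT.
by rewrite !inE spine_in // !orbT.
Qed.

Lemma children_spine i : i < k.*2 ->
  children (x i) :&: D = if i == 0 then [set u0; x 1] else [set x i.+1].
Proof.
move=> ik; apply/setP => c; apply/idP/idP.
  rewrite inE => /andP[]; rewrite inE => /andP[cr /eqP pc].
  rewrite inE => /orP[cc | cC].
    case: (core_parent cc cr) => [cu | [j jk cj]].
      move: pc; rewrite cu u0par -{1}x0 => /spine_inj <- //; last exact: ltnW.
      by rewrite !inE eqxx.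
    move: pc; rewrite cj xpar // => /(spine_inj (ltnW jk) (ltnW ik)) <-.
    by case: eqP => [->|_]; rewrite !inE eqxx ?orbT.
  have [_ pc' _] := extra_child cC.
  by have := spine_in ik; rewrite -pc pc' (negPf uls).
have xin j : j < k.*2 -> x j.+1 \in children (x j) :&: D.
  move=> jk; rewrite inE core_labelled ?spine_core // inE xpar // eqxx !andbT.
  by apply/eqP => /(spine_root jk).
case: (eqVneq i 0) ik => [-> ik | _ ik]; last first.
  by rewrite in_set1 => /eqP->; apply: xin.
rewrite in_set2 => /orP[] /eqP->; last exact: xin.
rewrite inE core_labelled ?inE ?eqxx // u0par x0 eqxx !andbT.
by apply: contraNneq u0s => ->; exact: root_in_spine.
Qed.

Lemma children_end : children ul :&: D = C.
Proof.
apply/setP => c; apply/idP/idP; last first.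
  by move=> cC; rewrite inE (subsetP Cul) // inE cC orbT.
rewrite inE => /andP[]; rewrite inE => /andP[cr /eqP pc].
rewrite inE => /orP[cc|//].
by have := core_parent_in cc cr; rewrite pc (negPf uls).
Qed.

Lemma children_off v : v \notin s -> v != ul -> children v :&: D = set0.
Proof.
move=> vs vl; apply/setP => c; rewrite [RHS]inE; apply/negP.
rewrite inE => /andP[]; rewrite inE => /andP[cr /eqP pc].
rewrite inE => /orP[cc | cC].
  by have := core_parent_in cc cr; rewrite pc (negPf vs).
by have [_ pc' _] := extra_child cC; rewrite -pc pc' eqxx in vl.
Qed.

Lemma unpaired_degree_spine v : v \in s -> unpaired_degree D v = 2.
Proof.
case/spineP=> i ik ->; rewrite /unpaired_degree children_spine //.
have [-> | i0] := eqVneq i 0.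
  rewrite x0 eqxx cards2; case: eqVneq => // e; case/negP: u0s.
  by rewrite e spine_in //; move: k0; clear; lia.
by rewrite cards1; case: (eqVneq (x i) r) i0 => // /(spine_root (ltnW ik)) ->.
Qed.

Lemma end_root : ul != r.
Proof. by apply: contraNneq uls => ->; exact: root_in_spine. Qed.

Lemma unpaired_degree_end : unpaired_degree D ul = #|C|.+1.
Proof. by rewrite /unpaired_degree children_end end_root. Qed.

Lemma unpaired_degree_off v : v \notin s -> v != ul -> unpaired_degree D v = 1.
Proof.
move=> vs vl; rewrite /unpaired_degree children_off // cards0 addn0.
by case: eqVneq vs => // ->; rewrite root_in_spine.
Qed.

Lemma even_core v : ~~ odd #|children v :\: D|.
Proof.
have := odd_degree v; rewrite (unpaired_degreeE D).
have [vs | vs] := boolP (v \in s); first by rewrite unpaired_degree_spine //; lia.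
have [-> | vl] := eqVneq v ul; first by rewrite unpaired_degree_end; move: Cev; lia.
by rewrite unpaired_degree_off //; lia.
Qed.

Lemma even_order : ~~ odd #|T|.
Proof.
have rD : r \in D by rewrite !inE root_in_spine !orbT.
have := even_unlabelled rD even_core; rewrite -(cardsC D) oddD => /negPf->.
rewrite addbF cardsU card_core.
have -> : core :&: C = set0.
  apply/setP => c; rewrite in_setI in_set0; apply/negP => /andP[cc].
  by case/extra_child => _ _; rewrite cc.
by rewrite cards0; move: Cev; lia.
Qed.

Variable g : T -> nat.

(** The label of [x i].  The value 1, which the formula for even [i] would give
    to the root, goes to [u0] instead; the root gets 0. *)
Definition zigzag i :=
  if i == 0 then 0 else if odd i then #|T| - k + i./2 else i./2.+1.

Definition spine_label z :=
  if z == u0 then 1 else if z \in s then zigzag (index z s) else g z.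

Let f := spine_label.

Lemma order_gt : k.*2.+1 < #|T|.
Proof. by rewrite -card_core max_card. Qed.

Lemma zigzag_range i : i < k.*2 ->
  zigzag i != 1 /\ (zigzag i <= k \/ #|T| - k <= zigzag i < #|T|).
Proof.
move=> ik; move: order_gt ik (odd_double_half i); rewrite /zigzag.
by case: (eqVneq i 0) => [->|] //; case: (odd i); clear; lia.
Qed.

Lemma zigzag_inj i j : i < k.*2 -> j < k.*2 -> zigzag i = zigzag j -> i = j.
Proof.
move=> ik jk; move: order_gt ik jk (odd_double_half i) (odd_double_half j).
rewrite /zigzag.
case: (eqVneq i 0); case: (eqVneq j 0); case: (odd i); case: (odd j); clear; lia.
Qed.

(** [zigzag_low] and [zigzag_high]: together with the label 1 of [u0] the
    zigzag uses all labels up to [k] and all labels from [#|T| - k] on, a set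
    that is closed under complement. *)
Lemma zigzag_low t : t <= k -> t != 1 -> exists2 i, i < k.*2 & zigzag i = t.
Proof.
move=> tk t1; have [-> | t0] := eqVneq t 0; first by exists 0 => //; lia.
exists (t.-1.*2); first lia.
rewrite /zigzag odd_double doubleK.
have -> : (t.-1.*2 == 0) = false by move: t0 t1; clear; lia.
by move: t0; clear; lia.
Qed.

Lemma zigzag_high t : #|T| - k <= t < #|T| -> exists2 i, i < k.*2 & zigzag i = t.
Proof.
move=> tk; have nk := order_gt; exists (t - (#|T| - k)).*2.+1; first lia.
rewrite /zigzag /= odd_double uphalf_double.
by rewrite subnKC //; case/andP: tk.
Qed.

Lemma label_u0 : f u0 = 1.
Proof. by rewrite /f /spine_label eqxx. Qed.

Lemma label_spine i : i < k.*2 -> f (x i) = zigzag i.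
Proof.
move=> ik; have xs := spine_in ik; rewrite /f /spine_label xs.
case: eqP xs => [->|_ _]; first by rewrite (negPf u0s).
by rewrite /x index_uniq ?sz.
Qed.

Let B := ul |: C.

Lemma label_tail z : z \in B -> f z = g z.
Proof.
rewrite !inE /f /spine_label => /orP[/eqP->|/extra_child[_ _]].
  by rewrite eq_sym (negPf u0l) (negPf uls).
by rewrite !inE !negb_or => /and3P[/negPf-> _ /negPf->].
Qed.

Lemma labelled_cases z :
  z \in D -> [\/ z = u0, exists2 i, i < k.*2 & z = x i | z \in B].
Proof.
rewrite !inE => /orP[/or3P[/eqP->|/eqP->|/spineP]|->]; 
  last by constructor 3; rewrite orbT.
- by constructor 1.
- by constructor 3; rewrite eqxx.
by constructor 2.
Qed.

Hypotheses (g_inj : {in B &, injective g})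
  (g_range : {in B, forall z, k < g z < #|T| - k})
  (g_half : exists2 z, z \in B & (g z).*2 = #|T|)
  (g_compl : {in B, forall z, exists2 z', z' \in B & g z' = #|T| - g z}).

Lemma tail_labelled z : z \in B -> z \in D.
Proof. by rewrite !inE => /orP[->|->]; rewrite ?orbT. Qed.

Lemma u0_labelled : u0 \in D.
Proof. by rewrite !inE eqxx. Qed.

Lemma spine_labelled i : i < k.*2 -> x i \in D.
Proof. by move=> ik; rewrite !inE spine_in ?orbT. Qed.

Lemma spine_labelling : partial_labelling D f.
Proof.
have nk := order_gt.
have low t : t <= k -> exists2 z, z \in D & f z = t.
  move=> tk; have [->|t1] := eqVneq t 1.
    by exists u0; rewrite ?u0_labelled ?label_u0.
  have [i ik <-] := zigzag_low tk t1.
  by exists (x i); rewrite ?label_spine ?spine_labelled.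
have high t : #|T| - k <= t < #|T| -> exists2 z, z \in D & f z = t.
  case/zigzag_high => i ik <-.
  by exists (x i); rewrite ?label_spine ?spine_labelled.
split.
- split; first by rewrite !inE root_in_spine !orbT.
  by rewrite -x0 label_spine //; lia.
- move=> a b aD bD.
  case: (labelled_cases aD) (labelled_cases bD)
      => [->|[i ik ->]|aB] [->|[j jk ->]|bB];
    rewrite ?label_u0 ?label_spine ?label_tail //.
  + by case: (zigzag_range jk) => nz _ e; rewrite -e eqxx in nz.
  + by have := g_range bB; move: k0; clear; lia.
  + by case: (zigzag_range ik) => nz _ e; rewrite e eqxx in nz.
  + by move/zigzag_inj => ->.
  + by have := g_range bB; case: (zigzag_range ik) => _; clear; lia.
  + by have := g_range aB; move: k0; clear; lia.
  + by have := g_range aB; case: (zigzag_range jk) => _; clear; lia.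
  + exact: g_inj.
- move=> z /labelled_cases[->|[i ik ->]|zB];
    rewrite ?label_u0 ?label_spine ?label_tail //; first by lia.
    by case: (zigzag_range ik) => _; lia.
  by have := g_range zB; lia.
- by have [z zB zn] := g_half; exists z; rewrite ?label_tail ?tail_labelled.
- move=> z /labelled_cases[->|[i ik ->]|zB];
    rewrite ?label_u0 ?label_spine ?label_tail // => z0.
  + by apply: high; lia.
  + case: (zigzag_range ik) => _ [h|h]; [apply: high; lia|apply: low; lia].
  by have [z' z'B <-] := g_compl zB; exists z'; rewrite ?label_tail ?tail_labelled.
exact: even_core.
Qed.

Section Extension.
Variable L : T -> nat.
Hypotheses (Linj : injective L) (Lf : {in D, L =1 f}).

Lemma ext_spine i : i < k.*2 -> L (x i) = zigzag i.
Proof. by move=> ik; rewrite Lf ?spine_labelled ?label_spine. Qed.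

Lemma ext_u0 : L u0 = 1.
Proof. by rewrite Lf ?u0_labelled ?label_u0. Qed.

Lemma ext_tail z : z \in B -> L z = g z.
Proof. by move=> zB; rewrite Lf ?tail_labelled ?label_tail. Qed.

(** The small and the large labels, which are the residues of the sums along the
    path, are all used on the path itself, except for the label 1 of [u0]. *)
Lemma off_label v : v \notin s -> L v < #|T| -> v = u0 \/ k < L v < #|T| - k.
Proof.
move=> vs vn; have [Lk | kL] := leqP (L v) k.
  have [e | t1] := eqVneq (L v) 1; first by left; apply: Linj; rewrite e ext_u0.
  have [i ik iv] := zigzag_low Lk t1.
  by move: vs; rewrite -(Linj (etrans (ext_spine ik) iv)) spine_in.
have [//= | nL] := ltnP (L v) (#|T| - k); first by right.
have [|i ik iv] := @zigzag_high (L v); first by rewrite nL.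
by move: vs; rewrite -(Linj (etrans (ext_spine ik) iv)) spine_in.
Qed.

Lemma unpaired_sum_spine i :
  i.+1 < k.*2 -> unpaired_sum D L (x i) = #|T| - k + i.+1.
Proof.
move=> ik; have nk := order_gt.
rewrite /unpaired_sum children_spine ?ext_spine ?(ltnW ik) //.
have [i0 | i0] := eqVneq i 0.
  rewrite i0 in ik *; rewrite big_setU1 ?big_set1 /= ?ext_u0 ?ext_spine //.
    by rewrite /zigzag /=; lia.
  by rewrite inE; apply: contraNneq u0s => ->; exact: spine_in.
rewrite big_set1 ext_spine // /zigzag (negPf i0) /=.
by case: ifP => oi; rewrite ?oi /=; lia.
Qed.

Lemma unpaired_sum_last : unpaired_sum D L (x k.*2.-1) = #|T|.-1 + g ul.
Proof.
have nk := order_gt; have ik : k.*2.-1 < k.*2 by lia.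
rewrite /unpaired_sum children_spine // ext_spine //.
have -> : (k.*2.-1 == 0) = false by lia.
rewrite big_set1 prednK ?spine_last; last by lia.
rewrite ext_tail ?inE ?eqxx // /zigzag; congr (_ + _).
have -> : (k.*2.-1 == 0) = false by move: k0; clear; lia.
have -> : odd k.*2.-1 by move: k0; clear; lia.
by move: nk k0; clear; lia.
Qed.

Lemma unpaired_sum_end : unpaired_sum D L ul = g ul + \sum_(c in C) g c.
Proof.
rewrite /unpaired_sum children_end ext_tail ?inE ?eqxx //; congr (_ + _).
by apply: eq_bigr => c cC; rewrite ext_tail // !inE cC orbT.
Qed.

Lemma unpaired_sum_off v : v \notin s -> v != ul -> unpaired_sum D L v = L v.
Proof. by move=> vs vl; rewrite /unpaired_sum children_off // big_set0 addn0. Qed.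

End Extension.

End Extra.

(** This is [resolved] for the case that occurs with [m = 1], a vertex of degree
    [a] off the path and a vertex of degree [b] on it. *)
Definition balanced (flip : bool) (a b : nat) :=
  if flip then a + 1 != b else a != b + 1.

Lemma half_order : exists2 h, #|T| = h.*2 & k < h.
Proof.
have ev := even_order (sub0set _) (C := set0); rewrite cards0 in ev.
exists #|T|./2; first by rewrite even_halfK ?ev.
by move: order_gt (ev isT); clear; lia.
Qed.

(** The first labelling: [ul] gets [#|T| / 2], and [w], if [core] is not
    everything, gets [#|T| / 2 - 1].  The progression of sums along the path
    stops one short of the end, and the sum at the last vertex collides with
    [w].  If [core] is everything, then the label [#|T| / 2 - 1] lies on the path
    except when [k = 1], where it belongs to [u0] and [x_k] is the last vertex. *)
Lemma antimagic_half_end flip :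
  balanced flip (degree u0) (degree (x k)) ->
  core = setT \/
  (exists2 w, w \notin core & balanced flip (degree w) (degree (x k.*2.-1))) ->
  antimagic T.
Proof.
move=> bal_u0 bal_w; have [h n_h kh] := half_order.
have Cul : set0 \subset children ul := sub0set _.
have Cev : ~~ odd #|@set0 T| by rewrite cards0.
pose g (z : T) := h.
have tail_ul z : z \in ul |: set0 -> z = ul by rewrite !inE orbF => /eqP.
have ul_tail : ul \in ul |: set0 by rewrite !inE eqxx.
have pf : partial_labelling (core :|: set0) (spine_label g).
  apply: spine_labelling => //.
  - by move=> a b /tail_ul -> /tail_ul ->.
  - by move=> z _; rewrite /g n_h; move: kh; clear; lia.
  - by exists ul.
  - by move=> z _; exists ul => //; rewrite /g n_h; clear; lia.
set D := core :|: set0 in pf *.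
have main L : injective L -> (forall v, L v < #|T|) -> {in D, L =1 spine_label g} ->
    (forall v, v \notin s -> (L v).+1 = h ->
       balanced flip (degree v) (degree (x k.*2.-1))) ->
    forall v v' m, v != v' ->
    unpaired_sum D L v' = unpaired_sum D L v + #|T| * m ->
    resolved flip D v v' m.
  move=> Linj Lbd LD bal_last.
  have sumO v : v \notin s -> unpaired_sum D L v = L v.
    move=> vs; have [-> | vl] := eqVneq v ul; last exact: unpaired_sum_off.
    rewrite (unpaired_sum_end Cul LD) big_set0 addn0.
    by rewrite (ext_tail Cul LD).
  have sum_last : unpaired_sum D L (x k.*2.-1) = h.*2.-1 + h.
    by rewrite (unpaired_sum_last Cul Cev LD) n_h.
  have unpairedO v : v \notin s -> unpaired_degree D v = 1.
    move=> vs; have [-> | vl] := eqVneq v ul; last exact: unpaired_degree_off.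
    by rewrite unpaired_degree_end // cards0.
  have Lu0 : L u0 = 1 by apply: (ext_u0 (C := set0) LD).
  have off_range v : v \notin s -> L v < #|T| - k.
    move=> vs; case: (off_label Cul Cev Linj LD vs (Lbd v)) => [->|];
      last by case/andP.
    by rewrite Lu0 n_h; move: k0 kh; clear; lia.
  have lst : x k.*2.-1 \in s by rewrite spine_in //; move: k0; clear; lia.
  have cls v : [\/ exists i, [/\ i.+1 < k.*2, v = x i,
                     unpaired_sum D L v = #|T| - k + i.+1 &
                     unpaired_degree D v = 2],
      [/\ v = x k.*2.-1, unpaired_sum D L v = h.*2.-1 + h &
          unpaired_degree D v = 2] |
      [/\ v \notin s, unpaired_sum D L v = L v & unpaired_degree D v = 1]].
    have [vs | vs] := boolP (v \in s); last first.
      by constructor 3; rewrite unpairedO ?sumO.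
    have fv : unpaired_degree D v = 2 by rewrite unpaired_degree_spine.
    case/spineP: vs fv => i ik -> fv.
    have [ik' | ik'] := ltnP i.+1 k.*2.
      by constructor 1; exists i; rewrite (unpaired_sum_spine Cul Cev LD).
    have il : i = k.*2.-1 by move: ik ik' k0; clear; lia.
    by constructor 2; rewrite -sum_last -il.
  move=> v v' m vv'.
  have mP := muln_small #|T| m; rewrite /resolved.
  case: (cls v) (cls v') => [[i [ik xv -> ->]]|[xv -> ->]|[vs -> ->]]
    [[j [jk xv' -> ->]]|[xv' -> ->]|[vs' -> ->]].
  - move=> e; have ij : i = j by move: mP e jk ik kh n_h; clear; lia.
    by rewrite xv xv' ij eqxx in vv'.
  - move=> e; suff: False by []; move: mP e n_h kh ik; clear; lia.
  - move=> e; suff: False by [].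
    by have := off_range _ vs'; move: (Lbd v') e n_h kh; clear; lia.
  - move=> e; suff: False by []; move: mP e n_h kh jk; clear; lia.
  - by rewrite xv xv' eqxx in vv'.
  - move=> e; suff: False by []; move: (Lbd v') e n_h kh; clear; lia.
  - move=> e; have [m1 Lj] : m = 1 /\ L v + k = j.+1.
      by have := off_range _ vs; move: mP e n_h kh jk; clear; lia.
    have vu0 : v = u0.
      case: (off_label Cul Cev Linj LD vs (Lbd v)) => // h1.
      by move: h1 Lj jk; clear; lia.
    have jk' : j = k by move: Lj; rewrite vu0 Lu0; clear; lia.
    by move: bal_u0; rewrite m1 xv' jk' vu0 /balanced; case: (flip); clear; lia.
  - move=> e; have [m1 Lv] : m = 1 /\ (L v).+1 = h.
      by have := Lbd v; move: mP e n_h kh; clear; lia.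
    by have := bal_last v vs Lv; rewrite m1 xv' /balanced; case: (flip); clear; lia.
  - move=> e; have m0 : #|T| * m = 0 by have := Lbd v'; move: mP e n_h; clear; lia.
    by case/negP: vv'; rewrite m0 addn0 in e; rewrite (Linj _ _ e).
case: bal_w => [coreT | [w wc bal_w]].
  apply: (antimagic_extension (D := D) (w := r) (t := 0) (flip := flip) pf).
    by have [-> ->] := label_root pf.
  move=> L Linj Lbd LD _; apply: main => // v vs Lv.
  have : v \in core by rewrite coreT inE.
  rewrite !inE (negPf vs) orbF => /orP[/eqP vu | /eqP vl]; last first.
    by move: Lv; rewrite vl (ext_tail Cul LD) // => /eqP; rewrite eqn_leq ltnn.
  have k1 : k = 1.
    have := card_core; rewrite coreT cardsT n_h.
    by move: Lv; rewrite vu (ext_u0 (C := set0) LD) => <-; clear; lia.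
  by rewrite k1 vu in bal_u0 *.
have kh' : k.+1 < h.
  have : core \proper setT.
    by rewrite properT; apply: contraNneq wc => ->; rewrite inE.
  by move/proper_card; rewrite card_core cardsT n_h; clear; lia.
have wD : w \notin D by rewrite /D setU0.
apply: (antimagic_extension (D := D) (w := w) (t := h.-1) (flip := flip) pf).
  rewrite (negPf wD); split; first by rewrite n_h; move: kh; clear; lia.
  move=> z /labelled_cases[->|[i ik ->]|zB].
  - by rewrite label_u0; move: kh' k0; clear; lia.
  - rewrite label_spine //; case: (zigzag_range ik) => _; rewrite n_h.
    by move: kh'; clear; lia.
  by rewrite (label_tail Cul) // /g; move: kh; clear; lia.
move=> L Linj Lbd LD Lw; apply: main => // v vs Lv.
suff -> : v = w by [].
by apply: Linj; rewrite Lw -Lv.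
Qed.

(** The second labelling: [ul] gets [k + 1], its children [c1] and [c2] get
    [#|T| / 2] and [#|T| - k - 1].  The sum at [ul] is [#|T| / 2] modulo [#|T|],
    the label of [c1]; three edges at [ul] are unpaired, and therefore [resolved]
    only asks for different degrees, whatever [flip] is. *)
Lemma antimagic_split_end flip c1 c2 :
  c1 \in children ul -> c2 \in children ul -> c1 != c2 ->
  balanced flip (degree u0) (degree (x k)) -> degree c1 != degree ul ->
  antimagic T.
Proof.
move=> c1l c2l c12 bal_u0 deg_c1; have [h n_h kh] := half_order.
pose C := [set c1; c2].
have Cul : C \subset children ul.
  by apply/subsetP => c; rewrite in_set2 => /orP[/eqP->|/eqP->].
have Cev : ~~ odd #|C| by rewrite cards2 c12.
have Cnl c : c \in C -> c != ul.
  by case/(extra_child Cul) => _ _; apply: contraNneq => ->; rewrite !inE eqxx orbT.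
have c1C : c1 \in C by rewrite !inE eqxx.
have c2C : c2 \in C by rewrite !inE eqxx orbT.
have kh' : k.+1 < h.
  have := max_card (mem (core :|: C)); rewrite cardsU card_core cards2 c12 n_h.
  have -> : core :&: C = set0.
    apply/setP => c; rewrite in_set0 in_setI; apply/negP => /andP[cc].
    by case/(extra_child Cul) => _ _; rewrite cc.
  by rewrite cards0; clear; lia.
pose g (z : T) := if z == ul then k.+1 else if z == c1 then h else #|T| - k.+1.
have gl : g ul = k.+1 by rewrite /g eqxx.
have g1 : g c1 = h by rewrite /g (negPf (Cnl _ c1C)) eqxx.
have g2 : g c2 = #|T| - k.+1 by rewrite /g (negPf (Cnl _ c2C)) eq_sym (negPf c12).
have tailP z : z \in ul |: C -> [\/ z = ul, z = c1 | z = c2].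
  by rewrite !inE => /or3P[] /eqP->; [constructor 1|constructor 2|constructor 3].
have pf : partial_labelling (core :|: C) (spine_label g).
  apply: spine_labelling => //.
  - move=> a b /tailP[]-> /tailP[]->; rewrite ?gl ?g1 ?g2 // ?n_h;
      move: kh'; clear; lia.
  - by move=> z /tailP[]->; rewrite ?gl ?g1 ?g2 ?n_h; move: kh'; clear; lia.
  - by exists c1; rewrite ?g1 // !inE eqxx orbT.
  - move=> z /tailP[]->.
    + by exists c2; rewrite ?g2 ?gl // !inE eqxx !orbT.
    + by exists c1; rewrite ?g1 ?n_h ?inE ?eqxx ?orbT //; clear; lia.
    by exists ul; rewrite ?gl ?g2 ?n_h ?inE ?eqxx //; move: kh'; clear; lia.
set D := core :|: C in pf *.
apply: (antimagic_extension (D := D) (w := r) (t := 0) (flip := flip) pf).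
  by have [-> ->] := label_root pf.
move=> L Linj Lbd LD _ v v' m vv'.
have Lu0 : L u0 = 1 by apply: (ext_u0 (C := C) LD).
have cls z : [\/ exists i, [/\ i < k.*2, z = x i,
                   unpaired_sum D L z = #|T| - k + i.+1 & unpaired_degree D z = 2],
    [/\ z = ul, unpaired_sum D L z = h.*2 + h & unpaired_degree D z = 3] |
    [/\ z = u0 \/ k < L z, L z < #|T| - k, unpaired_sum D L z = L z &
        unpaired_degree D z = 1]].
  have [zs | zs] := boolP (z \in s).
    constructor 1.
    have fz : unpaired_degree D z = 2 by rewrite unpaired_degree_spine.
    case/spineP: zs fz => i ik -> fz; exists i; split=> //.
    have [ik' | ik'] := ltnP i.+1 k.*2.
      by rewrite (unpaired_sum_spine Cul Cev LD).
    have -> : i = k.*2.-1 by move: ik ik' k0; clear; lia.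
    rewrite (unpaired_sum_last Cul Cev LD) gl n_h; move: kh k0; clear; lia.
  have [zl | zl] := eqVneq z ul.
    constructor 2; split=> //; rewrite zl; last first.
      by rewrite unpaired_degree_end // cards2 c12.
    rewrite (unpaired_sum_end Cul LD) gl big_setU1 ?inE //= big_set1 g1 g2 n_h.
    by move: kh'; clear; lia.
  constructor 3; rewrite unpaired_degree_off // unpaired_sum_off //.
  case: (off_label Cul Cev Linj LD zs (Lbd z)) => [zu | /andP[kz zk]];
    last by split=> //; right.
  by split=> //; [left | rewrite zu Lu0 n_h; move: kh k0; clear; lia].
have mP := muln_small #|T| m; rewrite /resolved.
case: (cls v) (cls v') => [[i [ik xv -> ->]]|[xv -> ->]|[lowv upv -> ->]]
  [[j [jk xv' -> ->]]|[xv' -> ->]|[lowv' upv' -> ->]].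
- move=> e; have ij : i = j by move: mP e jk ik kh n_h; clear; lia.
  by rewrite xv xv' ij eqxx in vv'.
- move=> e; suff: False by []; move: mP e n_h kh ik; clear; lia.
- move=> e; suff: False by []; move: e n_h kh upv'; clear; lia.
- move=> e; suff: False by []; move: mP e n_h kh jk; clear; lia.
- by rewrite xv xv' eqxx in vv'.
- move=> e; suff: False by []; move: e n_h kh upv'; clear; lia.
- move=> e; have [m1 Lj] : m = 1 /\ L v + k = j.+1.
    by move: mP e n_h kh jk upv; clear; lia.
  have vu0 : v = u0 by case: lowv => // h1; move: h1 Lj jk; clear; lia.
  have jk' : j = k by move: Lj; rewrite vu0 Lu0; clear; lia.
  by move: bal_u0; rewrite m1 xv' jk' vu0 /balanced; case: (flip); clear; lia.
- move=> e; have [m1 Lv] : m = 1 /\ L v = h.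
    by move: mP e n_h kh upv; clear; lia.
  have -> : v = c1.
    by apply: Linj; rewrite Lv (ext_tail Cul LD) ?g1 // !inE eqxx orbT.
  by move: deg_c1; rewrite m1 xv'; case: (flip); clear; lia.
- move=> e; have m0 : #|T| * m = 0 by move: mP e n_h upv'; clear; lia.
  by case/negP: vv'; rewrite m0 addn0 in e; rewrite (Linj _ _ e).
Qed.

(** A deepest vertex outside [core] has no children, because the parents of the
    vertices in [core] lie on the path. *)
Lemma leaf_off_core : core != setT -> exists2 w, w \notin core & degree w = 1.
Proof.
rewrite -subTset => /subsetPn[w0 _ w0c].
have [w /= wc wmax] := @arg_maxnP T w0 [pred w | w \notin core] d w0c.
exists w => //; have wr : w != r.
  by apply: contraNneq wc => ->; rewrite !inE root_in_spine !orbT.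
rewrite degree_children wr; apply/eqP; rewrite eqSS cards_eq0.
apply/eqP/setP => c; rewrite [RHS]inE; apply/negP; rewrite inE => /andP[cr /eqP pc].
have [cc | cc] := boolP (c \in core); last first.
  by have := wmax c cc; have := par_depth rT cr; rewrite pc ltnNge => /negP h /h.
have := core_parent_in cc cr; rewrite pc => ws.
by rewrite !inE ws !orbT in wc.
Qed.

(** In the last case all vertices off [core] have the same degree, hence are
    leaves, and [ul] has two children among them because its degree is odd and
    greater than 1. *)
Lemma antimagic_spine :
  degree u0 = 1 \/ 1 < degree ul -> antimagic T.
Proof.
move=> deg_end.
have deg_x i : i < k.*2 -> 1 < degree (x i).
  move=> ik; have Cul : set0 \subset children ul := sub0set _.
  have Cev : ~~ odd #|@set0 T| by rewrite cards0.
  have := unpaired_degree_le (core :|: set0) (x i).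
  by rewrite unpaired_degree_spine ?spine_in.
have [deg_u0 | deg_u0] := boolP (degree u0 != degree (x k) + 1).
  apply: (antimagic_half_end (flip := false)) => //.
  have [-> | ncore] := eqVneq core setT; first by left.
  right; have [w wc w1] := leaf_off_core ncore.
  exists w => //; rewrite w1 /balanced; have := deg_x k.*2.-1.
  by move: k0; clear; lia.
have deg_ul : 1 < degree ul.
  by case: deg_end => // u1; have := deg_x k; move: u1 deg_u0 k0; clear; lia.
have bal_u0 : balanced true (degree u0) (degree (x k)).
  by rewrite /balanced; move: deg_u0; clear; lia.
have [c1 [c2 [c1l c2l c12]]] : exists c1 c2,
    [/\ c1 \in children ul, c2 \in children ul & c1 != c2].
  have : 1 < #|children ul|.
    have := odd_degree ul; rewrite uls; move: deg_ul.
    by rewrite degree_children end_root; clear; lia.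
  by case/card_gt1P => c1 [c2 [? ? ?]]; exists c1, c2.
have c1c : c1 \notin core.
  have Cul : [set c1] \subset children ul by rewrite sub1set.
  by case: (extra_child Cul (set11 c1)).
have [w0 w0c w01] : exists2 w, w \notin core & degree w = 1.
  by apply: leaf_off_core; apply: contraNneq c1c => ->; rewrite inE.
have [/existsP[w /andP[wc bw]] | none] :=
    boolP [exists w, (w \notin core) &&
                     balanced true (degree w) (degree (x k.*2.-1))].
  by apply: (antimagic_half_end bal_u0); right; exists w.
have deg_off w : w \notin core -> degree w + 1 = degree (x k.*2.-1).
  by move=> wc; move/existsPn/(_ w): none; rewrite wc negbK => /eqP.
apply: (antimagic_split_end c1l c2l c12 bal_u0).
by move: (deg_off c1 c1c) (deg_off w0 w0c) deg_ul; rewrite w01; clear; lia.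
Qed.

End Spine.
End Rooted.

(** * Trees without a root *)

Lemma rooted_depth_ind (T : sgraph) (r : T) par d (P : T -> Prop) :
  rooted r par d -> P r -> (forall v, v != r -> P (par v) -> P v) -> forall v, P v.
Proof.
move=> rT Pr IH v; have [m] := ubnP (d v); elim: m v => // m IHm v dv.
have [-> // | vr] := eqVneq v r; apply: IH => //; apply: IHm.
by move: (par_depth rT vr) dv; clear; lia.
Qed.

(** [w] is a deepest vertex for an arbitrary root.  If its parent is a leaf too,
    then this parent is the root and [w] its only child, so the tree is
    [K_2]. *)
Lemma nonleaf_next_to_leaf (T : sgraph) :
  is_tree T -> 1 < #|T| -> ~ is_K2 T ->
  exists w r : T, [/\ adj r w, degree w = 1 & 1 < degree r].
Proof.
move=> hT T1 nK2; have /card_gt0P[r0 _] : 0 < #|T| by exact: ltnW.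
have [par [d rT]] := tree_rooted r0 hT.
have [w _ wmax] := @arg_maxnP T r0 predT d isT.
have chw : children r0 par w = set0.
  apply/setP => c; rewrite !inE; apply/negP => /andP[cr /eqP pc].
  by have := wmax c isT; have := par_depth rT cr; rewrite pc ltnNge => /negP h /h.
have wr0 : w != r0.
  apply: contraTneq T1 => w0; rewrite -leqNgt.
  have all0 v : v = r0.
    apply: (rooted_depth_ind (P := fun v => v = r0) rT) v => // v vr pv.
    have : v \in children r0 par w by rewrite inE vr pv w0 eqxx.
    by rewrite chw inE.
  rewrite -(cards1 r0) subset_leq_card //.
  by apply/subsetP => v _; rewrite inE (all0 v).
have w1 : degree w = 1 by rewrite (degree_children rT) chw cards0 wr0.
have wch : w \in children r0 par (par w) by rewrite inE wr0 eqxx.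
have adjw : adj (par w) w by rewrite (adj_par rT) wr0 eqxx orbT.
exists w, (par w); split=> //; rewrite ltnNge; apply/negP => deg1; apply: nK2.
have [pw0 ch1] : par w = r0 /\ children r0 par (par w) = [set w].
  move: deg1; rewrite (degree_children rT) (cardsD1 w) wch.
  case: eqVneq => [pw | _] //=; rewrite ltnS leqn0 cards_eq0 => /eqP h; split=> //.
  by rewrite -(setD1K wch) h setU0.
have all2 v : v \in [set r0; w].
  apply: (rooted_depth_ind (P := fun v => v \in [set r0; w]) rT) v => [|v vr];
    rewrite ?inE ?eqxx // => /orP[] /eqP pv.
    by rewrite orbC -in_set1 -ch1 inE vr pv pw0 eqxx.
  have : v \in children r0 par w by rewrite inE vr pv eqxx.
  by rewrite chw inE.
have T2 : #|T| = 2.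
  rewrite -cardsT; have -> : [set: T] = [set r0; w].
    by apply/setP => v; rewrite all2 inE.
  by rewrite cards2 eq_sym wr0.
by split; rewrite ?(card_edges rT) ?T2.
Qed.

Lemma antimagic_all_odd (T : sgraph) :
  is_tree T -> ~ is_K2 T -> (forall v : T, odd (degree v)) -> antimagic T.
Proof.
move=> hT nK2 all_odd; have /card_gt0P[v _] := hT.1.1.
have T1 : 1 < #|T|.
  have : 0 < degree v by have := all_odd v; case: (degree v).
  case/card_gt0P => w; rewrite inE => vw.
  have <- : #|[set v; w]| = 2.
    by rewrite cards2; case: eqP vw => // ->; rewrite adj_irrefl.
  exact: max_card.
have [w [r [rw w1 r1]]] := nonleaf_next_to_leaf hT T1 nK2.
have [par [d rT]] := tree_rooted r hT.
apply: (antimagic_all_odd_rooted rT) w1 r1 all_odd.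
by move: rw; rewrite (adj_par rT) eqxx inE /= => /andP[-> /eqP <-]; rewrite eqxx.
Qed.

Definition path_order (T : sgraph) (s : seq T) :=
  {in s &, forall x y, adj x y =
     (index y s == (index x s).+1) || (index x s == (index y s).+1)}.

Lemma path_order_rev (T : sgraph) (s : seq T) :
  uniq s -> path_order s -> path_order (rev s).
Proof.
move=> us os a b; rewrite !mem_rev => aS bS.
have idx c : c \in s ->
    index c (rev s) = size s - (index c s).+1 /\ index c s < size s.
  move=> cs; have ci : index c s < size s by rewrite index_mem.
  have lt : size s - (index c s).+1 < size s by move: ci; clear; lia.
  split=> //; have e : nth c (rev s) (size s - (index c s).+1) = c.
    by rewrite nth_rev // subnSK // subKn ?nth_index // ltnW.
  by rewrite -{1}e index_uniq ?rev_uniq ?size_rev.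
have [ia la] := idx a aS; have [ib lb] := idx b bS.
by rewrite os // ia ib; move: la lb; clear; lia.
Qed.

(** The first vertex of the path has even degree and one neighbour on the path,
    hence another neighbour, which is off the path. *)
Lemma end_neighbour (T : sgraph) (s : seq T) (z : T) :
  uniq s -> 1 < size s -> s =i V_even T -> path_order s ->
  exists2 u, u \notin s & adj (nth z s 0) u.
Proof.
move=> us s1 sE os; set r := nth z s 0; pose y := nth z s 1.
have rs : r \in s by rewrite mem_nth // ltnW.
have ys : y \in s by rewrite mem_nth.
have ir : index r s = 0 by rewrite index_uniq // ltnW.
have iy : index y s = 1 by rewrite index_uniq.
have ry : adj r y by rewrite os // ir iy.
have : ~~ odd (degree r) by move: rs; rewrite sE inE.
rewrite /degree (cardsD1 y) inE ry; set A := _ :\ y => evA.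
have /card_gt0P[u] : 0 < #|A| by move: evA; case: #|A|.
rewrite !inE => /andP[uy ru]; exists u => //; apply/negP => us'.
move: ru; rewrite os // ir /= orbF => /eqP iu.
by rewrite -(nth_index z us') iu /y eqxx in uy.
Qed.

Lemma antimagic_even_path (T : sgraph) (s : seq T) (k : nat) (u v : T) :
  is_tree T -> 0 < k -> size s = k.*2 -> uniq s -> s =i V_even T -> path_order s ->
  u \notin s -> v \notin s -> adj (nth v s 0) u -> adj (nth v s k.*2.-1) v ->
  degree u = 1 \/ 1 < degree v -> antimagic T.
Proof.
move=> hT k0 sz us sE os uS vS ru lv deg_uv.
set r := nth v s 0 in ru; have [par [d rT]] := tree_rooted r hT.
pose x i := nth v s i.
have xs i : i < k.*2 -> x i \in s by move=> ik; rewrite mem_nth ?sz.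
have xadj i : i < k.*2 -> adj (x i) (x i.+1).
  move=> ik; have [ik' | ik'] := ltnP i.+1 k.*2.
    by rewrite os ?xs // !index_uniq ?sz // eqxx.
  have -> : i = k.*2.-1 by move: ik ik'; clear; lia.
  by rewrite /x [nth v s _.+1]nth_default // sz prednK //; move: k0; clear; lia.
have xpar i : i < k.*2 -> par (x i.+1) = x i.
  elim: i => [|i IH] ik; have := xadj _ ik; rewrite (adj_par rT).
    by rewrite eqxx /= => /andP[_ /eqP].
  case/orP=> /andP[_ /eqP]; last by [].
  rewrite IH ?(ltnW ik) // => xii; have := xs i (ltnW ik).
  have [ik' | ik'] := ltnP i.+2 k.*2; last first.
    by rewrite -xii /x nth_default ?sz ?(negPf vS).
  by move/eqP: xii; rewrite /x nth_uniq ?sz //; move: ik'; clear; lia.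
apply: (antimagic_spine rT sz k0 us (u0 := u) (ul := v)) => //.
- have e : k.*2.-1.+1 = k.*2 by move: k0; clear; lia.
  have pv : par v = x k.*2.-1.
    have := xpar k.*2.-1; rewrite e leqnn /x [nth v s k.*2]nth_default ?sz //.
    by move->.
  apply: contraTneq ru => ->; rewrite (adj_par rT) eqxx pv negb_and eq_sym /r /x.
  by rewrite nth_uniq ?sz //; move: k0; clear; lia.
- by move: ru; rewrite (adj_par rT) eqxx => /andP[_ /eqP].
- by move=> z; rewrite sE inE negbK.
Qed.

Theorem theorem3 (T : sgraph) (hT : is_tree T) (hK2 : ~ is_K2 T)
    (hpath : induces_path (V_even T)) (heven : ~~ odd #|V_even T|) :
  antimagic T.
Proof.
have [s [us sE os]] := hpath.
have {}os : path_order s by move=> a b; rewrite !sE; apply: os.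
have card_s : #|V_even T| = size s.
  by rewrite -(card_uniqP us); apply: eq_card => z; rewrite sE.
have sz : size s = (size s)./2.*2 by rewrite even_halfK // -card_s.
have [k0 | k_gt0] := posnP (size s)./2.
  apply: antimagic_all_odd => // v; have := sE v.
  rewrite (size0nil (s := s)); last by rewrite sz k0.
  by rewrite !inE => /esym/negbFE.
have s1 : 1 < size s by rewrite sz; move: k_gt0; clear; lia.
have [z _] := card_gt0P hT.1.1.
have sE' : rev s =i V_even T by move=> v; rewrite mem_rev.
have us' : uniq (rev s) by rewrite rev_uniq.
have os' := path_order_rev us os.
have [u uS ru] := end_neighbour z us s1 sE os.
have [v vS lv] : exists2 v, v \notin s & adj (nth z s (size s).-1) v.
  have [|v] := end_neighbour z us' _ sE' os'; first by rewrite size_rev.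
  by rewrite mem_rev nth_rev ?subn1 //; [exists v | apply: ltnW].
have nth_def a b i : i < size s -> nth a s i = nth b s i.
  by move=> ik; apply: set_nth_default.
have [v1 | v1] := ltnP 1 (degree v).
  apply: (antimagic_even_path hT k_gt0 sz us sE os uS vS) => //; last by right.
    by rewrite (nth_def _ z) // ltnW.
  by rewrite -sz (nth_def _ z) // prednK // ltnW.
(* [v] is a leaf: walk the path backwards, starting next to [v] *)
have deg_v : degree v = 1.
  have : odd (degree v) by apply: contraNT vS => ev; rewrite sE inE.
  by move: v1; case: (degree v) => [|[]].
apply: (antimagic_even_path (s := rev s) (u := v) (v := u) hT k_gt0) => //.
- by rewrite size_rev.
- by rewrite mem_rev.
- by rewrite mem_rev.
- by rewrite nth_rev ?subn1 ?(nth_def _ z) ?prednK // ltnW.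
- rewrite -sz nth_rev ?prednK ?subnn ?(nth_def _ z) //; try exact: ltnW.
- by left.
Qed.
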